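(* Let $n\ge2$ and let $S\subset\mathbb{R}^n$ be a nonempty locally closed subset for which there exist collections $\{L_i\}$, $\{L'_j\}$, $\{A_i\}$ forming a Khintchine system for $S$ (defined in the context). Then there exist uncountably many totally irrational $\boldsymbol{\xi}\in S$ such that $\hat{\omega}(\boldsymbol{\xi})\ge\frac{1}{n-1}$.
   Context: A set $S\subset\mathbb{R}^n$ is locally closed if there is an open set $\mathcal{W}\subset\mathbb{R}^n$ with $S=\overline{S}\cap\mathcal{W}$. Write $\|\boldsymbol{x}\|=\max_j|x_j|$; for $x\in\mathbb{R}$ let $\langle x\rangle$ be the distance from $x$ to the nearest integer, and $\langle\boldsymbol{x}\rangle=(\langle x_1\rangle,\ldots,\langle x_n\rangle)$ for $\boldsymbol{x}\in\mathbb{R}^n$. For a primitive vector $\mathbf{m}=(m_0,m_1,\ldots,m_n)\in\mathbb{Z}^{n+1}$ with $(m_1,\ldots,m_n)\neq 0$, put $A_{\mathbf{m}}=\{\boldsymbol{\xi}\in\mathbb{R}^n:\sum_{i=1}^n m_i\xi_i=m_0\}$ and $|A_{\mathbf{m}}|=\|(m_1,\ldots,m_n)\|$. The sets $A_{\mathbf{m}}$ are the rational affine hyperplanes. Khintchine system for $S$: disjoint (countable) collections $\{L_1,L_2,\ldots\}$ and $\{L'_1,L'_2,\ldots\}$ of distinct closed subsets of $S$ (closed in $S$), each contained in a rational affine hyperplane, together with, for each $i$, a rational affine hyperplane $A_i\supset L_i$, such that (closures taken in $S$): (a) $\bigcup_i L_i\cup\bigcup_j L'_j=\{\boldsymbol{x}\in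 S:\boldsymbol{x}\text{ is contained in a rational affine hyperplane}\}$; (b) for each $i$ and each $T>0$, $L_i=\overline{\bigcup_{j:\,|A_j|>T}(L_i\cap L_j)}$; (c) for each $i$ and any finite sets of indices $F,F'$ with $i\notin F$, $L_i=\overline{L_i\smallsetminus(\bigcup_{k\in F}L_k\cup\bigcup_{k'\in F'}L'_{k'})}$; (d) $\bigcup_i L_i$ is dense in $S$. A vector $\boldsymbol{\xi}\in\mathbb{R}^n$ is totally irrational if $1,\xi_1,\ldots,\xi_n$ are linearly independent over $\mathbb{Q}$. The uniform exponent in the sense of simultaneous approximation $\hat{\omega}(\boldsymbol{\xi})$ is the supremum of those $\gamma>0$ for which, for all $t$ large enough, there is an integer $q$ with $\|\langle q\boldsymbol{\xi}\rangle\|\le t^{-\gamma}$ and $0<q\le t$. *)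

(* Defs.v *)
From HB Require Import structures.
From mathcomp Require Import all_boot all_order all_algebra.
From mathcomp Require Import all_classical all_reals all_analysis.

Set Implicit Arguments.
Unset Strict Implicit.
Unset Printing Implicit Defensive.

Import Order.TTheory GRing.Theory Num.Theory.
Import numFieldNormedType.Exports.

Local Open Scope classical_set_scope.
Local Open Scope ring_scope.

Definition locally_closed (T : topologicalType) (S : set T) : Prop :=
  exists2 W : set T, open W & S = closure S `&` W.

(* In [subspace S] every point outside [S] is isolated and open, so for
   [X `<=` S] these are the usual closure in S and closedness in S. *)
Definition closure_in (T : topologicalType) (S X : set T) : set T :=
  closure (X : set (subspace S)).

Definition closed_in (T : topologicalType) (S X : set T) : Prop :=
  X `<=` S /\ closed (X : set (subspace S)).

(* A rational affine hyperplane A_m of R^n is given by its coefficient vector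
   m = (m_0, m_1, ..., m_n), with m_0 in column [ord0] and m_i (i >= 1) in
   column [lift ord0 (i - 1)]. *)
Section RationalHyperplanes.
Variable n : nat.
Implicit Types m : 'rV[int]_n.+1.

Definition primitive m : Prop :=
  \big[gcdn/0%N]_(i < n.+1) `|m ord0 i|%N = 1%N.

Definition hyperplane_coeffs m : Prop :=
  primitive m /\ exists i : 'I_n, m ord0 (lift ord0 i) != 0.

Definition hyperplane (R : realType) m : set 'rV[R]_n :=
  [set x | \sum_(i < n) (m ord0 (lift ord0 i))%:~R * x ord0 i
           = (m ord0 ord0)%:~R].

(* |A_m|; it does not involve m_0. A primitive m is determined by A_m up to
   sign, so this depends on A_m only. *)
Definition height m : nat := \max_(i < n) `|m ord0 (lift ord0 i)|%N.

End RationalHyperplanes.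

(* The countable collections are {L i | i in I} and {L' j | j in J}; index sets
   I, J in nat allow finite, empty and infinite collections. *)
Record khintchine_system (R : realType) (n : nat) (S : set 'rV[R]_n)
    (I J : set nat) (L L' : nat -> set 'rV[R]_n)
    (A : nat -> 'rV[int]_n.+1) : Prop := KhintchineSystem {
  ks_L_distinct : forall i k, I i -> I k -> L i = L k -> i = k ;
  ks_L'_distinct : forall j k, J j -> J k -> L' j = L' k -> j = k ;
  ks_disjoint : forall i j, I i -> J j -> L i <> L' j ;
  ks_L_closed : forall i, I i -> closed_in S (L i) ;
  ks_L'_closed : forall j, J j -> closed_in S (L' j) ;
  ks_L_hyperplane : forall i, I i ->
    hyperplane_coeffs (A i) /\ L i `<=` hyperplane (A i) ;
  ks_L'_hyperplane : forall j, J j ->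
    exists m, hyperplane_coeffs m /\ L' j `<=` hyperplane m ;
  ks_a : \bigcup_(i in I) L i `|` \bigcup_(j in J) L' j =
    [set x | S x /\ exists m, hyperplane_coeffs m /\ hyperplane m x] ;
  ks_b : forall i (T : R), I i -> 0 < T ->
    L i = closure_in S
      (\bigcup_(j in [set j | I j /\ T < (height (A j))%:R]) (L i `&` L j)) ;
  ks_c : forall i (F F' : set nat), I i ->
    finite_set F -> F `<=` I -> finite_set F' -> F' `<=` J -> ~ F i ->
    L i = closure_in S
      (L i `\` (\bigcup_(k in F) L k `|` \bigcup_(k in F') L' k)) ;
  ks_d : closure_in S (\bigcup_(i in I) L i) = S
}.

Definition totally_irrational (R : realType) (n : nat) (xi : 'rV[R]_n) : Prop :=
  forall (c0 : rat) (c : 'rV[rat]_n),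
    ratr c0 * 1 + \sum_(i < n) ratr (c ord0 i) * xi ord0 i = 0 :> R ->
    c0 = 0 /\ c = 0.

Definition dist_int (R : realType) (x : R) : R :=
  inf [set `|x - k%:~R| | k in [set: int]].

(* The norm of ['rV[R]_n] is the maximum norm [mx_norm]. *)
Definition unif_exponent (R : realType) (n : nat) (xi : 'rV[R]_n) : \bar R :=
  ereal_sup [set gamma%:E | gamma in [set gamma : R | 0 < gamma /\
    \forall t \near +oo, exists q : int,
      [/\ 0 < q, q%:~R <= t &
          `|map_mx (@dist_int R) (q%:~R *: xi)| <= t `^ (- gamma)]]].

(* Main.v *)
Require Import Defs.
From mathcomp Require Import all_boot all_order all_algebra.
From mathcomp Require Import all_classical all_reals all_analysis.
From mathcomp Require Import ring lra zify.
Import Order.TTheory GRing.Theory Num.Theory.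
Import numFieldNormedType.Exports.
Local Open Scope classical_set_scope.
Local Open Scope ring_scope.

Set Implicit Arguments.
Unset Strict Implicit.
Unset Printing Implicit Defensive.

(** Khintchine's construction of singular vectors: choose a point so near a
    rational hyperplane that the linear form of this hyperplane is tiny compared
    with the height of a second one, much higher, then so near the second
    compared with the height of a third, and so on. A Khintchine system lets
    this run inside [S]: by [ks_b] the piece [L i] meets pieces [L i'] of larger
    height, near any of its points, and by [ks_c] there are points of [L i'] off
    finitely many other pieces, near any of its points. Nested balls built this
    way, within the open set in which [S] is relatively closed, converge to a
    point [xi] of [S] off all the pieces, hence totally irrational by [ks_a]
    ([totally_irrationalP]). For every large [k] some integer linear form of
    height at most [k] has absolute value at most [Phi k] at [xi], where [Phi]
    is positive, nonincreasing and otherwise arbitrary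
    ([approximable_point_exists]).

    The construction also avoids any countable set of totally irrational
    points, at no cost: at every stage the centre lies on a rational
    hyperplane, so it differs from these points and the ball can be shrunk to
    miss one more of them. So the set in the theorem cannot be countable.

    It remains to pass from linear forms to simultaneous approximation. If an
    integer form of height [M] nearly vanishes at [xi], then a line through the
    origin in the direction [(1, xi)] nearly lies in a rational hyperplane of
    [R ^ (n + 1)], and one coordinate of an integer point on that hyperplane is
    determined by the others. A pigeonhole argument with only [n - 1] free
    coordinates, and a congruence modulo [M], gives errors [1 / K] with
    [q <= K ^ (n - 1) * M] ([simultaneous_of_linear_form]). With
    [Phi k = 1 / k ^ k] the factor [M] may be taken smaller than any power of
    [K], which gives the exponent [1 / (n - 1)] ([unif_exponent_ge]). *)

(** * Integer linear forms and rational hyperplanes *)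

Definition linear_form (R : realType) (n : nat) (m : 'rV[int]_n.+1)
    (x : 'rV[R]_n) : R :=
  \sum_(i < n) (m ord0 (lift ord0 i))%:~R * x ord0 i - (m ord0 ord0)%:~R.

Lemma hyperplaneE (R : realType) (n : nat) (m : 'rV[int]_n.+1) (x : 'rV[R]_n) :
  hyperplane m x <-> linear_form m x = 0.
Proof.
rewrite /hyperplane /linear_form /=; split=> [->|/eqP]; first by rewrite subrr.
by rewrite subr_eq0 => /eqP.
Qed.

Lemma linear_form_continuous (R : realType) (n : nat) (m : 'rV[int]_n.+1) :
  continuous (@linear_form R n m).
Proof.
move=> x; rewrite /linear_form.
apply: continuousB; last exact: cst_continuous.
apply: (@cvg_big _ _ _ _ _ add_continuous _ (nbhs x)) => i _.
by apply: cvgM; [exact: cvg_cst|exact: coord_continuous].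
Qed.

Lemma height_gt0 (n : nat) (m : 'rV[int]_n.+1) :
  hyperplane_coeffs m -> (0 < height m)%N.
Proof.
case=> _ [i mi]; rewrite /height.
apply: leq_trans (@leq_bigmax _ (fun j : 'I_n => `|m ord0 (lift ord0 j)|%N) i).
by rewrite absz_gt0.
Qed.

Lemma primitive_multiple (n : nat) (v : 'rV[int]_n.+1) : v != 0 ->
  exists (g : int) (m : 'rV[int]_n.+1),
    [/\ g != 0, primitive m & v = g *: m].
Proof.
move=> v0; pose g := \big[gcdn/0%N]_(i < n.+1) `|v ord0 i|%N.
have gdvd i : (g %| `|v ord0 i|)%N by apply: (@biggcdn_inf _ i).
have g0 : (0 < g)%N.
  have /rV0Pn[i vi] := v0.
  by apply: dvdn_gt0 (gdvd i); rewrite absz_gt0.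
have vE i : v ord0 i = g%:Z * (v ord0 i %/ g%:Z)%Z.
  by rewrite mulrC divzK// dvdzE.
exists g%:Z, (\row_i (v ord0 i %/ g%:Z)%Z); split.
- by rewrite -lt0n in g0 *; lia.
- rewrite /primitive; set h := \big[_/_]_(_ < _) _.
  have : (g * h %| g)%N.
    apply/dvdn_biggcdP => i _; rewrite vE abszM/= dvdn_pmul2l//.
    by apply: (@biggcdn_inf _ i) => //; rewrite mxE.
  by rewrite -[X in (_ %| X)%N]muln1 dvdn_pmul2l// dvdn1 => /eqP.
- by apply/rowP => i; rewrite !mxE -vE.
Qed.

(** A rational relation between [1, xi_1, .., xi_n] becomes the equation of a
    rational hyperplane after clearing denominators, for which the relation is
    read as a polynomial over [rat], and dividing by the gcd of the resulting
    integers. *)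
Lemma totally_irrationalP (R : realType) (n : nat) (xi : 'rV[R]_n) :
  totally_irrational xi <->
  (forall m, hyperplane_coeffs m -> ~ hyperplane m xi).
Proof.
split=> [ti m [_ [i mi]] /hyperplaneE|nh c0 c].
  rewrite /linear_form => mxi.
  have [|_ /rowP/(_ i)] :=
    ti (- (m ord0 ord0)%:~R) (\row_i (m ord0 (lift ord0 i))%:~R).
    rewrite mulr1 rmorphN/= ratr_int addrC -[RHS]mxi; congr (_ - _).
    by apply: eq_bigr => k _; rewrite mxE ratr_int.
  by rewrite !mxE => /eqP; rewrite intr_eq0; apply/negP.
rewrite mulr1 => cxi.
(* A relation with [c = 0] reads [c0 = 0], so a nontrivial one has some
   [c_i != 0]: it does define a hyperplane. *)
suff c_eq0 : c = 0.
  move: cxi; rewrite c_eq0 big1 ?addr0; last first.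
    by move=> i _; rewrite mxE raddf0 mul0r.
  by move/eqP; rewrite fmorph_eq0 => /eqP.
apply/eqP/negPn/negP => /rV0Pn[i ci].
pose p : {poly rat} :=
  \poly_(k < n.+1) (row_mx c0%:M c : 'rV_(1 + n)) ord0 (inord k).
have [q [a a0 pq]] := rat_poly_scale p.
have pqE (k : 'I_n.+1) :
    (row_mx c0%:M c : 'rV_(1 + n)) ord0 k = a%:~R^-1 * (q`_k)%:~R.
  have := congr1 (fun P : {poly rat} => P`_k) pq.
  by rewrite /p coef_poly ltn_ord inord_val coefZ coef_map.
have c0E : c0 = a%:~R^-1 * (q`_0)%:~R.
  rewrite -(pqE ord0) (_ : ord0 = lshift n (ord0 : 'I_1)).
    by rewrite row_mxEl mxE mulr1n.
  exact/val_inj.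
have cE (k : 'I_n) : c ord0 k = a%:~R^-1 * (q`_k.+1)%:~R.
  rewrite -(pqE (lift ord0 k)) (_ : lift ord0 k = rshift 1 k) ?row_mxEr//.
  exact/val_inj.
(* The constant term moves to the right-hand side in the equation of a
   hyperplane, whence the sign in column 0. *)
pose v : 'rV[int]_n.+1 := \row_k (if k == ord0 then - q`_0 else q`_k).
have vS (k : 'I_n) : v ord0 (lift ord0 k) = q`_k.+1.
  by rewrite mxE.
have v0 : v ord0 (lift ord0 i) != 0.
  by rewrite vS; apply: contraNneq ci; rewrite cE => ->; rewrite mulr0.
have [|g [m [g0 mP vE]]] := @primitive_multiple n v.
  by apply: contraNneq v0 => ->; rewrite mxE.
have aR0 : a%:~R != 0 :> R by rewrite intr_eq0.
apply: (nh m).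
  split=> //; exists i; apply: contraNneq v0 => mi.
  by rewrite vE mxE mi mulr0.
apply/hyperplaneE/eqP.
have gR0 : g%:~R != 0 :> R by rewrite intr_eq0.
rewrite -(mulrI_eq0 _ (mulfI gR0)) -(mulrI_eq0 _ (mulfI (invr_neq0 aR0))).
rewrite /linear_form -[X in _ == X]cxi; apply/eqP.
rewrite !mulrBr addrC; congr (_ + _).
  have -> : c0 = - a%:~R^-1 * (v ord0 ord0)%:~R.
    by rewrite mxE eqxx rmorphN mulrNN.
  rewrite vE mxE rmorphM rmorphN/= fmorphV/= !ratr_int intrM; ring.
rewrite !mulr_sumr; apply: eq_bigr => k _.
rewrite cE -vS vE mxE rmorphM/= fmorphV/= !ratr_int intrM; ring.
Qed.

(** * From linear forms to simultaneous approximation *)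

Lemma truncn_scaled_eq_dist (R : realType) (K : nat) (u v : R) :
  (0 < K)%N -> 0 <= u -> 0 <= v ->
  Num.truncn (K%:R * u) = Num.truncn (K%:R * v) -> `|u - v| <= K%:R^-1.
Proof.
move=> K0 u0 v0 uv.
have K0R : (0 : R) < K%:R by rewrite ltr0n.
have /andP[] := truncn_itv (mulr_ge0 (ltW K0R) u0).
have /andP[] := truncn_itv (mulr_ge0 (ltW K0R) v0).
rewrite uv -natr1 => v1 v2 u1 u2.
rewrite -(ler_pM2l K0R) divff ?gt_eqF// -[X in X * _](gtr0_norm K0R) -normrM.
by rewrite ler_norml; apply/andP; split; lra.
Qed.

(** Uniform transference, by the pigeonhole principle. Let [M] be the largest
    coefficient of the form, at index [j0]. Put [q] in a box according to the
    fractional parts of [q * xi_i] for [i != j0], cut into [K] intervals, and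
    according to the residue modulo [M] of
    [m_0 * q - \sum_(i != j0) m_i * floor (q * xi_i)]. Among [K ^ n * M + 1]
    values of [q] two share a box. Their difference is [1/K]-close to an integer
    in every coordinate but [j0]; equality of the residues says that the
    equation of the hyperplane, with these integers in it, has an integer
    solution [p] in the missing coordinate, and since [M] is the largest
    coefficient the equation bounds the error in that coordinate as well. *)
Lemma simultaneous_of_linear_form (R : realType) (n : nat)
    (xi : 'rV[R]_n.+1) (m : 'rV[int]_n.+2) (K : nat) :
  (0 < K)%N -> (0 < height m)%N ->
  exists q : nat, [/\ (0 < q)%N, (q <= K ^ n * height m)%N &
    forall i, exists p : int, `|q%:R * xi ord0 i - p%:~R| <=
      q%:R * `|linear_form m xi| + n%:R / K%:R].
Proof.
move=> K0 M0.
have [j0 hj0] : {j0 : 'I_n.+1 | height m = `|m ord0 (lift ord0 j0)|%N}.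
  apply: (bigop.eq_bigmax (fun j : 'I_n.+1 => `|m ord0 (lift ord0 j)|%N)).
  by rewrite card_ord.
have hle i : (`|m ord0 (lift ord0 i)| <= height m)%N.
  exact: (@leq_bigmax _ (fun j : 'I_n.+1 => `|m ord0 (lift ord0 j)|%N) i).
set M := height m in hj0 hle M0 *.
pose c i : int := m ord0 (lift ord0 (lift j0 i)).
pose y (q : nat) (i : 'I_n) : R := q%:R * xi ord0 (lift j0 i).
pose fl q i : int := Num.floor (y q i).
have frac_ge0 q i : 0 <= y q i - (fl q i)%:~R.
  by rewrite subr_ge0 Num.Theory.floor_le.
have frac_lt1 q i : y q i - (fl q i)%:~R < 1.
  by rewrite ltrBlDl -[1]/(1%:~R) -intrD floorD1_gt.
have K0R : (0 : R) < K%:R by rewrite ltr0n.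
pose bin q i : nat := Num.truncn (K%:R * (y q i - (fl q i)%:~R)).
have binK q i : (bin q i < K)%N.
  rewrite truncn_lt_nat ?(mulr_ge0 (ltW K0R))//.
  by rewrite -[X in _ < X]mulr1 ltr_pM2l// frac_lt1.
pose res (q : nat) : int := m ord0 ord0 * q%:Z - \sum_(i < n) c i * fl q i.
have MZ0 : (M%:Z != 0 :> int) by rewrite -lt0n in M0 *; lia.
have resM e : (`|(res e %% M%:Z)%Z| < M)%N.
  have h1 := modz_ge0 (res e) MZ0.
  have h2 : (res e %% M%:Z < M%:Z)%Z by apply: ltz_pmod; lia.
  lia.
pose f (e : 'I_(K ^ n * M).+1) : {ffun 'I_n -> 'I_K} * 'I_M :=
  ([ffun i => Ordinal (binK e i)], Ordinal (resM e)).
have [a [b [ab fab]]] : exists a b : 'I_(K ^ n * M).+1, (a < b)%N /\ f a = f b.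
  have /injectivePn[a [b ab fab]] : ~~ injectiveb f.
    apply/negP => /injectiveP/leq_card; rewrite card_prod card_ffun !card_ord.
    by rewrite ltnn.
  case: (ltngtP a b) => h; [by exists a, b | by exists b, a |].
  by move: ab; rewrite -val_eqE /= h eqxx.
case: fab => /ffunP fbin fres.
have {}fbin i : bin a i = bin b i by have := fbin i; rewrite !ffunE => -[].
have Mdvd : (m ord0 (lift ord0 j0) %| res b - res a)%Z.
  rewrite dvdzE -hj0 -[M]/(`|M%:Z|%N) -dvdzE -eqz_mod_dvd; apply/eqP.
  have ha := modz_ge0 (res a) MZ0.
  have hb := modz_ge0 (res b) MZ0.
  by rewrite -(gez0_abs ha) -(gez0_abs hb) fres.
have /dvdzP[p hp] := Mdvd.
exists (b - a)%N; split; first by rewrite subn_gt0.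
  by rewrite (leq_trans (leq_subr _ _))// -ltnS.
have qE : (b - a)%:R = b%:R - a%:R :> R by rewrite natrB// ltnW.
have close i :
    `|(b - a)%:R * xi ord0 (lift j0 i) - (fl b i - fl a i)%:~R| <= K%:R^-1.
  have := truncn_scaled_eq_dist K0 (frac_ge0 b i) (frac_ge0 a i)
    (esym (fbin i)).
  by rewrite /y qE intrB; congr (`|_| <= _); ring.
have form_ge0 : 0 <= (b - a)%:R * `|linear_form m xi|.
  by rewrite mulr_ge0.
move=> i; case: (unliftP j0 i) => [i' ->|->].
  exists (fl b i' - fl a i'); apply: (le_trans (close i')).
  rewrite -[X in X <= _]add0r lerD// -[X in X <= _]mul1r.
  by rewrite ler_pM2r ?invr_gt0// ler1n (leq_trans _ (ltn_ord i')).
exists p.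
have M1R : (1 : R) <= M%:R by rewrite ler1n.
have MM : M%:R = `|(m ord0 (lift ord0 j0))%:~R| :> R.
  by rewrite hj0 -intr_norm natr_absz.
(* The value of the form, solved for the coordinate [j0]. *)
have key : (m ord0 (lift ord0 j0))%:~R *
    ((b - a)%:R * xi ord0 j0 - p%:~R) =
    (b - a)%:R * linear_form m xi - \sum_(i < n) (c i)%:~R *
      ((b - a)%:R * xi ord0 (lift j0 i) - (fl b i - fl a i)%:~R) :> R.
  have hpR : (m ord0 (lift ord0 j0))%:~R * p%:~R =
     (m ord0 ord0)%:~R * (b - a)%:R
       - \sum_(i < n) (c i)%:~R * (fl b i - fl a i)%:~R :> R.
    rewrite -intrM mulrC -hp /res qE.
    have -> : \sum_(i < n) (c i)%:~R * (fl b i - fl a i)%:~R =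
        \sum_(i < n) (c i * fl b i)%:~R - \sum_(i < n) (c i * fl a i)%:~R :> R.
      by rewrite -sumrB; apply: eq_bigr => k _; rewrite -intrM -intrB mulrBr.
    rewrite !intrB !intrM !raddf_sum/= !sumrN -!pmulrn; ring.
  rewrite mulrBr hpR /linear_form (bigD1_ord j0)//=.
  have -> : \sum_(i < n) (c i)%:~R *
        ((b - a)%:R * xi ord0 (lift j0 i) - (fl b i - fl a i)%:~R) =
      (b - a)%:R * (\sum_(i < n) (c i)%:~R * xi ord0 (lift j0 i)) -
      \sum_(i < n) (c i)%:~R * (fl b i - fl a i)%:~R.
    by rewrite mulr_sumr -sumrB; apply: eq_bigr => k _; ring.
  by rewrite /c; ring.
have M0R : (0 : R) < M%:R by rewrite ltr0n.
rewrite -(ler_pM2l M0R) {1}MM -normrM key.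
apply: (le_trans (ler_normB _ _)); rewrite [leRHS]mulrDr; apply: lerD.
  by rewrite normrM normr_nat -[X in X <= _]mul1r ler_wpM2r.
apply: (le_trans (ler_norm_sum _ _ _)).
apply: (@le_trans _ _ (\sum_(i < n) M%:R * K%:R^-1)).
  apply: ler_sum => k _; rewrite normrM ler_pM//.
  by rewrite -intr_norm -natr_absz ler_nat hle.
by rewrite sumr_const card_ord -[X in X <= _]mulr_natr mulrAC mulrA.
Qed.

Lemma dist_int_ge0 (R : realType) (x : R) : 0 <= dist_int x.
Proof. by apply: lb_le_inf => [|_ [k _ <-]//]; exists `|x - 0%:~R|, 0. Qed.

Lemma dist_int_le (R : realType) (x : R) (k : int) : dist_int x <= `|x - k%:~R|.
Proof. by apply: ge_inf; [exists 0 => _ [? _ <-]|exists k]. Qed.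

Lemma norm_dist_int_le (R : realType) (n : nat) (x : 'rV[R]_n) (d : R) :
  0 <= d -> (forall i, exists p : int, `|x ord0 i - p%:~R| <= d) ->
  `|map_mx (@dist_int R) x| <= d.
Proof.
move=> d0 xd; rewrite [leLHS]mx_normrE; apply: bigmax_le => // -[i j] _ /=.
rewrite mxE ger0_norm ?dist_int_ge0// ord1.
by have [p] := xd j; apply: le_trans; exact: dist_int_le.
Qed.

(** Uniform approximability in the dual sense, for one linear form in [n]
    variables, at the speed [Phi]. *)
Definition approx_by_linear_forms (R : realType) (n : nat) (Phi : nat -> R)
    (xi : 'rV[R]_n) : Prop :=
  exists k0, forall k, (k0 <= k)%N -> exists m : 'rV[int]_n.+1,
    [/\ (0 < height m)%N, (height m <= k)%N & `|linear_form m xi| <= Phi k].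

(** Write [t = u ^ D] with [D = (s + 1) * n + 1], let [k] be the integer part of
    [u], and apply the pigeonhole transference to a form of height at most [k]
    with [K = k ^ (s + 1)]: then [q <= K ^ n * k = k ^ D <= t]. The value of the
    form is negligible, so the error is of order [u ^ - (s + 1)], that is
    [t ^ - ((s + 1) / D)], and [(s + 1) / D] tends to [1 / n] as [s] grows. *)
Lemma simultaneous_below_critical (R : realType) (n : nat)
    (xi : 'rV[R]_n.+1) (gamma : R) :
  approx_by_linear_forms (fun k => (k%:R ^+ k)^-1) xi ->
  0 < gamma -> gamma * n%:R < 1 ->
  \forall t \near +oo, exists q : int,
      [/\ 0 < q, q%:~R <= t &
          `|map_mx (@dist_int R) (q%:~R *: xi)| <= t `^ (- gamma)].
Proof.
move=> [k0 xiP] g0 gn.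
(* One power of [u] is kept in reserve, to absorb the multiplicative
   constants: [s] stands here in place of [s + 1]. *)
have [s sP] : exists s : nat, gamma * (s.+1 * n).+1%:R <= s%:R.
  pose B := (gamma + gamma * n%:R) / (1 - gamma * n%:R).
  have gn' : 0 < 1 - gamma * n%:R by rewrite subr_gt0.
  exists (Num.truncn B).+1.
  have /andP[_] : _ <= B < _ := truncn_itv (divr_ge0 (addr_ge0 (ltW g0)
     (mulr_ge0 (ltW g0) (ler0n _ _))) (ltW gn')).
  rewrite ltr_pdivrMr// => h.
  have succE (a : nat) : a.+1%:R = a%:R + 1 :> R by rewrite natr1.
  rewrite (succE (_ * _)%N) natrM (succE (Num.truncn B).+1); lra.
set D := (s.+1 * n).+1 in sP.
have [C [C_k0 C_D C_n]] : exists C,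
    [/\ (k0 <= C)%N, (D + s.+1 <= C)%N & (n.+1 * 2 ^ s.+1 <= C)%N].
  exists (k0 + (D + s.+1) + n.+1 * 2 ^ s.+1)%N.
  by rewrite leq_addl -addnA leq_addr addnCA leq_addr.
have C1 : (1 <= C)%N by apply: leq_trans C_D; rewrite addnS.
near=> t.
have tC : C%:R ^+ D <= t by near: t; exact: nbhs_pinfty_ge.
have t0 : 0 <= t by apply: le_trans tC; rewrite exprn_ge0.
pose u := t `^ D%:R^-1.
have u0 : 0 <= u := powR_ge0 _ _.
have uD : u ^+ D = t.
  by rewrite -powR_mulrn// -powRrM mulVf ?pnatr_eq0// powRr1.
have Cu : C%:R <= u by rewrite -(@ler_pXn2r _ D)// ?nnegrE// uD.
pose k := Num.truncn u.
have Ck : (C <= k)%N by rewrite truncn_ge_nat.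
have /andP[ku uk] := truncn_itv u0; rewrite -/k in ku uk.
have k_gt0 : (0 < k)%N := leq_trans C1 Ck.
have k0R : 0 < k%:R :> R by rewrite ltr0n.
have k1R : 1 <= k%:R :> R by rewrite ler1n.
have u_gt0 : 0 < u by apply: lt_le_trans ku.
have u1 : 1 <= u by apply: le_trans ku.
have u2k : u <= 2 * k%:R by move: uk; rewrite -natr1; lra.
have [|m [m0 mk mxi]] := xiP k; first exact: leq_trans Ck.
have [|q [q0 qle qxi]] := @simultaneous_of_linear_form R n xi m (k ^ s.+1) _ m0.
  by rewrite expn_gt0 k_gt0.
have qkD : (q <= k ^ D)%N.
  by rewrite (leq_trans qle)// -expnM /D expnS [leqRHS]mulnC leq_mul2l mk orbT.
exists q%:Z; split; first by rewrite ltz_nat.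
  rewrite -pmulrn -uD (@le_trans _ _ (k%:R ^+ D))//.
    by rewrite -natrX ler_nat.
  by rewrite lerXn2r ?nnegrE// ltW.
apply: (@le_trans _ _ (n.+1%:R / k%:R ^+ s.+1)).
  apply: norm_dist_int_le; first by rewrite divr_ge0// exprn_ge0// ltW.
  move=> i; have [p pP] := qxi i; exists p.
  rewrite !mxE -pmulrn (le_trans pP)// -natr1 mulrDl mul1r natrX addrC lerD//.
  apply: (@le_trans _ _ (k%:R ^+ D * (k%:R ^+ k)^-1)).
    by apply: ler_pM => //; rewrite -natrX ler_nat.
  rewrite ler_pdivrMr ?exprn_gt0// mulrC ler_pdivlMr ?exprn_gt0//.
  by rewrite -exprD ler_weXn2l// (leq_trans C_D).
have -> : t `^ (- gamma) = u `^ (- (gamma * D%:R)).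
  by rewrite -uD -[in LHS](powR_mulrn _ u0) -powRrM mulrC mulNr.
apply: (@le_trans _ _ (u `^ (- s%:R))); last first.
  by apply: ler_powR => //; rewrite lerN2.
rewrite powRN powR_mulrn// ler_pdivrMr ?exprn_gt0// mulrC ler_pdivlMr ?exprn_gt0//.
rewrite -(@ler_pM2r _ (2 ^+ s.+1)) ?exprn_gt0//.
apply: (@le_trans _ _ (u * u ^+ s)).
  rewrite mulrAC ler_wpM2r ?exprn_ge0//.
  by apply: le_trans Cu; rewrite -natrX -natrM ler_nat.
by rewrite -exprS -exprMn mulrC lerXn2r ?nnegrE// ?mulr_ge0// ltW.
Unshelve. all: by end_near. Qed.

Lemma unif_exponent_ge (R : realType) (n : nat) (xi : 'rV[R]_n) :
  (2 <= n)%N -> approx_by_linear_forms (fun k => (k%:R ^+ k)^-1) xi ->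
  ((1 / (n%:R - 1))%:E <= unif_exponent xi)%E.
Proof.
case: n xi => [|[|n]] // xi _ xiP; rewrite -natr1 addrK div1r.
have n0 : (0 : R) < n.+1%:R by rewrite ltr0n.
have below (gamma : R) : 0 < gamma -> gamma * n.+1%:R < 1 ->
    (gamma%:E <= unif_exponent xi)%E.
  move=> g0 g1; apply: ereal_sup_ubound; exists gamma => //; split=> //.
  exact: simultaneous_below_critical.
apply/lee_subgt0Pr => e e0.
(* The maximum keeps [gamma] positive when [e] is large. *)
pose gamma := Num.max (n.+1%:R^-1 - e) (n.+1%:R^-1 / 2).
apply: (@le_trans _ _ gamma%:E); first by rewrite -EFinB lee_fin le_max lexx.
apply: below; first by rewrite lt_max divr_gt0 ?invr_gt0// orbT.
rewrite -ltr_pdivlMr// mul1r gt_max ltrBlDr ltrDl e0/=.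
by rewrite ltr_pdivrMr// ltr_pMr ?invr_gt0// ltr1n.
Qed.

(** * Relative closures and nested balls *)

Lemma closure_in_meets (T : topologicalType) (S X U : set T) (x : T) :
  S x -> closure_in S X x -> nbhs x U -> X `&` U !=set0.
Proof.
move=> Sx clX xU; apply: (clX U).
case: (@nbhs_subspaceP T S x) => // _.
by apply: filterS xU => y Uy _.
Qed.

Lemma closed_in_avoid (T : topologicalType) (S X : set T) (x : T) :
  closed_in S X -> S x -> ~ X x -> nbhs x (~` X).
Proof.
move=> [XS /closed_subspaceP[V Vcl VX]] Sx nXx.
have VXE z : S z -> V z <-> X z.
  move=> Sz; have := congr1 (fun B : set T => B z) VX.
  rewrite /setI/= => E; split=> h.
    by have [] : X z /\ S z by rewrite -E.
  by have [] : V z /\ S z by rewrite E.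
apply: (@filterS _ _ _ (~` V)).
  by move=> z nVz Xz; apply/nVz/VXE => //; exact: XS.
apply: open_nbhs_nbhs; split; first exact: closed_openC.
by move/VXE => /(_ Sx).
Qed.

Lemma nested_closed_balls (R : realType) (n : nat) (x : nat -> 'rV[R]_n)
    (r : nat -> R) :
  (forall j, 0 < r j <= j.+1%:R^-1) ->
  (forall j, closed_ball (x j.+1) (r j.+1) `<=` closed_ball (x j) (r j)) ->
  exists2 y, x j @[j --> \oo] --> y & forall j, closed_ball (x j) (r j) y.
Proof.
move=> rP sub.
have r_gt0 j : 0 < r j by case/andP: (rP j).
have subD j k : (j <= k)%N -> closed_ball (x k) (r k) `<=` closed_ball (x j) (r j).
  elim: k => [|k IH]; first by rewrite leqn0 => /eqP ->.
  by rewrite leq_eqVlt => /predU1P[->//|/IH]; apply: subset_trans.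
have xin j k : (j <= k)%N -> closed_ball (x j) (r j) (x k).
  by move=> /subD; apply; exact: closed_ballxx.
have cx : cvg (x j @[j --> \oo]).
  apply/cauchy_cvgP/cauchy_exP => e e0.
  near \oo => j; exists (x j).
  exists j => // k /= jk; apply: (@closed_ball_subset _ _ _ (r j) e) => //.
    case/andP: (rP j) => _ /le_lt_trans; apply.
    near: j; exact: near_infty_natSinv_lt (PosNum e0).
  exact: xin.
exists (lim (x j @[j --> \oo])) => // j.
apply: (closed_cvg _ (@closed_ball_closed _ _ (x j) (r j)) _ _ cx).
by exists j => // k /= /xin.
Unshelve. all: by end_near. Qed.

(** * Khintchine's construction *)

Section KhintchineConstruction.
Variables (R : realType) (n : nat) (S : set 'rV[R]_n) (I J : set nat).
Variables (L L' : nat -> set 'rV[R]_n) (A : nat -> 'rV[int]_n.+1).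
Hypothesis KS : khintchine_system S I J L L' A.
(* The point to be built must avoid the sets [Z j]; they will be the singletons
   of a countable set of totally irrational points. *)
Variables (Phi : nat -> R) (Z : nat -> set 'rV[R]_n).
Hypothesis Phi_gt0 : forall k, 0 < Phi k.
Hypothesis Z_closed : forall j, closed (Z j).
Hypothesis LZ : forall i j, I i -> L i `&` Z j = set0.

Let L_sub i : I i -> L i `<=` S.
Proof. by move=> /(ks_L_closed KS)[]. Qed.

(** By [ks_b]. The point [z] lies on both hyperplanes, so the form of [A i]
    vanishes at a point of the next piece [L i']. *)
Lemma higher_hyperplane i (x : 'rV[R]_n) U : I i -> L i x -> nbhs x U ->
  exists i' z, [/\ I i', (height (A i) < height (A i'))%N, L i z, L i' z & U z].
Proof.
move=> Ii Lx xU; have hT : 0 < (height (A i))%:R :> R.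
  by rewrite ltr0n height_gt0//; have [] := ks_L_hyperplane KS Ii.
have := Lx; rewrite {1}(ks_b KS Ii hT) => clx.
have [z [[i' [/= Ii' hi'] [Lz L'z]] Uz]] :=
  closure_in_meets (L_sub Ii Lx) clx xU.
by exists i', z; split => //; rewrite -(ltr_nat R).
Qed.

(** By [ks_c]. Nothing is claimed on [L i] itself, which contains [y]. *)
Lemma avoid_others j i (z : 'rV[R]_n) U : I i -> L i z -> nbhs z U ->
  exists y, [/\ L i y, U y,
    forall k, I k -> (k <= j)%N -> k != i -> ~ L k y &
    forall k, J k -> (k <= j)%N -> ~ L' k y].
Proof.
move=> Ii Lz zU.
pose F := I `&` [set k | (k <= j)%N /\ k != i].
pose F' := J `&` [set k | (k <= j)%N].
have finj (B : set nat) : B `<=` [set k | (k <= j)%N] -> finite_set B.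
  by move=> Bj; apply: (sub_finite_set Bj); exact: (finite_II j.+1).
have Ffin : finite_set F by apply: finj => k [_ []].
have F'fin : finite_set F' by apply: finj => k [].
have nFi : ~ F i by move=> [_ [_]]; rewrite eqxx.
have := Lz.
rewrite {1}(ks_c KS Ii Ffin (@subIsetl _ _ _) F'fin (@subIsetl _ _ _) nFi) => clz.
have [y [[Ly nLy] Uy]] := closure_in_meets (L_sub Ii Lz) clz zU.
exists y; split => // k Bk kj => [ki|] Lky; apply: nLy.
  by left; exists k.
by right; exists k.
Qed.

Lemma nbhs_avoid_others j i (y : 'rV[R]_n) : I i -> L i y ->
  (forall k, I k -> (k <= j)%N -> k != i -> ~ L k y) ->
  (forall k, J k -> (k <= j)%N -> ~ L' k y) ->
  \forall x \near y, [/\ forall k, I k -> (k <= j)%N -> k != i -> ~ L k x,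
    forall k, J k -> (k <= j)%N -> ~ L' k x & ~ Z j x].
Proof.
move=> Ii Ly yL yL'; have Sy := L_sub Ii Ly.
have allk (P : nat -> 'rV[R]_n -> Prop) :
    (forall k, (k <= j)%N -> nbhs y (P k)) ->
    \forall x \near y, forall k, (k <= j)%N -> P k x.
  move=> yP; apply: filterS (@filter_forall _ 'I_j.+1 (fun k => P k) (nbhs y) _
    (fun k => yP k (ltn_ord k))) => x Px k kj.
  exact: (Px (Ordinal (kj : (k < j.+1)%N))).
have h1 : \forall x \near y, forall k, (k <= j)%N -> I k -> k != i -> ~ L k x.
  apply: allk => k kj; have [Ik|nIk] := pselect (I k); last first.
    by apply: filterE => x /nIk.
  have [->|ki] := eqVneq k i; first by apply: filterE => x _.
  by apply: filterS (closed_in_avoid (ks_L_closed KS Ik) Sy (yL _ Ik kj ki)).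
have h2 : \forall x \near y, forall k, (k <= j)%N -> J k -> ~ L' k x.
  apply: allk => k kj; have [Jk|nJk] := pselect (J k); last first.
    by apply: filterE => x /nJk.
  by apply: filterS (closed_in_avoid (ks_L'_closed KS Jk) Sy (yL' _ Jk kj)).
have h3 : \forall x \near y, ~ Z j x.
  apply: open_nbhs_nbhs; split; first exact: closed_openC.
  by move=> Zy; have : (L i `&` Z j) y by []; rewrite LZ.
by apply: filterS3 h1 h2 h3 => x a b c; split=> // k *; [exact: a|exact: b].
Qed.

(* A stage is an index [i] and a closed ball, given by its centre, which lies
   in [L i], and its radius. *)
Let stage : Type := (nat * 'rV[R]_n * R)%type.
Let valid (s : stage) := [/\ I s.1.1, L s.1.1 s.1.2 & 0 < s.2].
Let cball (s : stage) := closed_ball s.1.2 s.2.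

(* From a stage to the next: at points of the new ball the old form is already
   as small as is required until the height of the new form is reached. The
   ball cannot avoid the piece that contains its centre, so step [j] avoids all
   the pieces of index at most [j] but the current one; that piece is left at
   the next step, since the heights grow. *)
Let refines j (s s' : stage) := [/\
  (height (A s.1.1) < height (A s'.1.1))%N,
  s'.2 <= j.+1%:R^-1,
  cball s' `<=` cball s,
  cball s' `<=`
    [set x | `|linear_form (A s.1.1) x| <= Phi (height (A s'.1.1))] &
  cball s' `<=` [set x | [/\
    forall k, I k -> (k <= j)%N -> k != s'.1.1 -> ~ L k x,
    forall k, J k -> (k <= j)%N -> ~ L' k x & ~ Z j x]]].

(* Near a point [z] of [L i] on a higher piece [L i'], the form of [i] is small;
   then [z] is moved within [L i'] to a point [y] off the other pieces. *)
Let next_stage j (s : stage) : valid s ->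
  exists s', valid s' /\ refines j s s'.
Proof.
case: s => [[i x] r] [/= Ii Lx r0].
have [i' [z [Ii' hi Lz L'z xz]]] := higher_hyperplane Ii Lx (nbhsx_ballx x r r0).
have form0 : linear_form (A i) z = 0.
  by apply/hyperplaneE; have [_] := ks_L_hyperplane KS Ii; apply.
pose V := [set w | `|linear_form (A i) w| < Phi (height (A i'))].
have Vopen : open V.
  have -> : V = (fun w => `|linear_form (A i) w|) @^-1`
      [set t | t < Phi (height (A i'))] by [].
  apply: open_comp; last exact: open_lt.
  move=> w _; apply: continuous_comp; first exact: linear_form_continuous.
  exact: norm_continuous.
have Uopen : open (ball x r `&` V) by apply: openI => //; exact: ball_open.
have zU : nbhs z (ball x r `&` V).
  by apply: open_nbhs_nbhs; split => //; split => //; rewrite /V /= form0 normr0.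
have [y [Ly Uy yL yL']] := avoid_others j Ii' L'z zU.
have yU : nbhs y (ball x r `&` V) by apply: open_nbhs_nbhs; split.
have [e eP] := (nbhs_closedballP _ _).1
  (filterI yU (nbhs_avoid_others Ii' Ly yL yL')).
exists (i', y, Num.min e%:num j.+1%:R^-1); split.
  by split => //=; rewrite lt_min invr_gt0 ltr0n andbT.
have sub : cball (i', y, Num.min e%:num j.+1%:R^-1) `<=` closed_ball y e%:num.
  by apply: le_closed_ball; rewrite ge_min lexx.
split => //=.
- by rewrite ge_min lexx orbT.
- by move=> w /sub/eP[[+ _] _]; exact: subset_closed_ball.
- by move=> w /sub/eP[[_ /ltW]].
- by move=> w /sub/eP[].
Qed.

(** The intersection of the balls of a sequence of stages. Between two
    successive heights the form of the lower height is the one that approximates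
    well enough; avoiding every piece means, by [ks_a], lying on no rational
    hyperplane. *)
Lemma approximable_point_exists : S !=set0 -> locally_closed S ->
  (forall k l, (k <= l)%N -> Phi l <= Phi k) ->
  exists xi, [/\ S xi, totally_irrational xi, forall j, ~ Z j xi &
    approx_by_linear_forms Phi xi].
Proof.
move=> [p Sp] [W Wopen SW] Phi_anti.
have [x0 [[i0 Ii0 Lx0] _]] : (\bigcup_(i in I) L i) `&` setT !=set0.
  apply: (closure_in_meets Sp); last exact: filterT.
  by rewrite (ks_d KS).
have Wx0 : W x0 by have := L_sub Ii0 Lx0; rewrite SW => -[].
have [r0 r0W] := (nbhs_closedballP _ _).1 (open_nbhs_nbhs (conj Wopen Wx0)).
have /choice[next nextP] (js : nat * stage) :
    exists s', valid js.2 -> valid s' /\ refines js.1 js.2 s'.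
  have [/(next_stage js.1)[s' ?]|] := pselect (valid js.2); first by exists s'.
  by exists js.2.
pose f := fix f j : stage :=
  if j is j'.+1 then next (j', f j') else (i0, x0, r0%:num).
have fvalid j : valid (f j).
  by elim: j => [|j IH]; [split=> /=|have [] := nextP (j, f j) IH].
have fref j : refines j (f j) (f j.+1).
  by have [] := nextP (j, f j) (fvalid j).
pose i_ j := (f j.+1).1.1.
have [|j|xi cvxi xiB] :=
    @nested_closed_balls R n (fun j => (f j.+1).1.2) (fun j => (f j.+1).2).
- by move=> j; have [_ _ ->] := fvalid j.+1; have [_ ->] := fref j.
- by have [] := fref j.+1.
have xiB0 : cball (f 0%N) xi by have [_ _ + _ _] := fref 0%N; apply; exact: xiB.
have Sxi : S xi.
  rewrite SW; split; last exact: r0W.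
  apply: (closed_cvg _ (@closed_closure _ S) _ _ cvxi); apply: nearW => j.
  by apply: subset_closure; have [Ij Lj _] := fvalid j.+1; exact: (L_sub Ij).
have far j := (let: And5 _ _ _ _ h := fref j in h) xi (xiB j).
have hmono j : (height (A (i_ j)) < height (A (i_ j.+1)))%N.
  by have [] := fref j.+1.
exists xi; split => //.
- apply/totally_irrationalP => m mP mxi.
  have : (\bigcup_(i in I) L i `|` \bigcup_(j in J) L' j) xi.
    by rewrite (ks_a KS); split => //; exists m.
  case=> -[k Bk Lk]; last by have [_ /(_ k Bk (leqnn k))] := far k.
  (* If step [k] stopped on the piece [L k] itself, step [k + 1] avoided it. *)
  have [ki|ki] := eqVneq k (i_ k).
    have [/(_ k Bk (leqnSn k)) + _ _] := far k.+1; apply => //.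
    apply/eqP => ki'; have := hmono k.
    by rewrite -ki [X in (_ < height (A X))%N]/(i_ k.+1) -ki' ltnn.
  by have [/(_ k Bk (leqnn k) ki)] := far k.
- by move=> j; have [] := far j.
have hge j : (j <= height (A (i_ j)))%N.
  by elim: j => // j IH; exact: leq_ltn_trans (hmono j).
exists (height (A (i_ 0%N))) => k hk.
have exP : exists j, (k < height (A (i_ j)))%N by exists k.+1; exact: hge.
have [[|j] kj jmin] := ex_minnP exP; first by rewrite ltnNge hk in kj.
exists (A (i_ j)); split.
- have [Ij _ _] := fvalid j.+1.
  by apply: height_gt0; have [] := ks_L_hyperplane KS Ij.
- by rewrite leqNgt; apply/negP => /jmin; rewrite ltnn.
- have [_ _ _ + _] := fref j.+1; move=> /(_ xi (xiB j.+1)) /= /le_trans; apply.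
  exact/Phi_anti/ltnW.
Qed.

End KhintchineConstruction.

(** * Uncountably many singular vectors *)

Theorem corollary1p3 (R : realType) (n : nat) (n_ge2 : (2 <= n)%N)
  (S : set 'rV[R]_n) (S_neq0 : S !=set0) (S_lc : locally_closed S)
  (S_khintchine : exists (I J : set nat) (L L' : nat -> set 'rV[R]_n)
    (A : nat -> 'rV[int]_n.+1), khintchine_system S I J L L' A) :
  ~ countable [set xi : 'rV[R]_n | [/\ S xi, totally_irrational xi &
      ((1 / (n%:R - 1))%:E <= unif_exponent xi)%E]].
Proof.
set C := [set xi | _] => /countable_injP[f finj].
case: S_khintchine => I [J [L [L' [A KS]]]].
pose Z j := C `&` [set x | f x = j].
have Z_closed j : closed (Z j).
  have [->|/set0P[x [Cx fx]]] := eqVneq (Z j) set0; first exact: closed0.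
  rewrite (_ : Z j = [set x]).
    exact: (accessible_closed_set1 (hausdorff_accessible (@norm_hausdorff _ _))).
  apply/seteqP; split=> [y [Cy fy]|_ ->//].
  by apply: finj; rewrite ?inE// fx.
have LZ i j : I i -> L i `&` Z j = set0.
  move=> Ii; rewrite -subset0 => x [Lx [[_ /totally_irrationalP xiP _] _]].
  have [Am AL] := ks_L_hyperplane KS Ii.
  by apply: (xiP _ Am); exact: AL.
pose Phi (k : nat) : R := (k%:R ^+ k)^-1.
have pow_gt0 k : (0 : R) < k%:R ^+ k.
  by case: k => [|k]; rewrite ?expr0 ?exprn_gt0 ?ltr0n.
have Phi_gt0 k : 0 < Phi k by rewrite invr_gt0.
have Phi_anti k l : (k <= l)%N -> Phi l <= Phi k.
  move=> kl; rewrite lef_pV2 ?posrE// -!natrX ler_nat.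
  case: k kl => [|k kl]; first by rewrite expn0 expn_gt0; case: (l).
  apply: leq_trans (leq_pexp2l (ltn0Sn k) kl) _.
  by rewrite leq_exp2r// (leq_trans _ kl).
have [xi [Sxi ti nZ ap]] :=
  approximable_point_exists KS Phi_gt0 Z_closed LZ S_neq0 S_lc Phi_anti.
by apply: (nZ (f xi)); split => //; split => //; exact: unif_exponent_ge.
Qed.
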